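(* For all integers $m>n\ge 1$, we have $d_{\mathrm{GH}}(B^m,B^n)\ge 1-\mathrm{cov}_{B^n}(m)$.
   Context: $B^n=\{x\in\mathbb{R}^n : x_1^2+\cdots+x_n^2\le 1\}$ is the closed unit ball, regarded as a metric space with the Euclidean metric. The Gromov--Hausdorff distance $d_{\mathrm{GH}}(X,Y)$ between metric spaces $X,Y$ is the infimum, over all metric spaces $Z$ and isometric embeddings $\phi\colon X\to Z$, $\psi\colon Y\to Z$, of the Hausdorff distance in $Z$ between $\phi(X)$ and $\psi(Y)$. Equivalently, $d_{\mathrm{GH}}(X,Y)=\frac12\inf_C \sup_{(x,y),(x',y')\in C}|d_X(x,x')-d_Y(y,y')|$, where $C$ ranges over all correspondences, i.e. relations $C\subseteq X\times Y$ whose projections to $X$ and to $Y$ are both surjective. For a compact metric space $X$ and an integer $m\ge 1$, the $m$-th covering radius of $X$ is \[ \mathrm{cov}_X(m)=\inf\{d_{\mathrm{H}}(P,X) \mid \emptyset\neq P\subseteq X,\ |P|\le m\}, \] where $d_{\mathrm{H}}$ denotes the Hausdorff distance between subsets of $X$. *)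

(* Defs.v *)
From HB Require Import structures.
From mathcomp Require Import all_boot all_order all_algebra.
From mathcomp Require Import all_classical all_reals all_analysis.
From mathcomp Require Import ring lra.
Import Order.TTheory GRing.Theory Num.Theory.
Import numFieldNormedType.Exports.

Set Implicit Arguments.
Unset Strict Implicit.
Unset Printing Implicit Defensive.

Local Open Scope classical_set_scope.
Local Open Scope ring_scope.

(* [edist] and [edist_inf] are the library's extended-real point-to-point and
   point-to-set distances of a pseudometric space, defined from its balls. In a
   metric space they are given by [mdist]. *)
Lemma edist_mdist (R : realType) (Z : metricType R) (x y : Z) :
  edist (x, y) = (mdist x y)%:E.
Proof.
apply/eqP; rewrite eq_le; apply/andP; split.
  apply/lee_addgt0Pr => e e0; rewrite -EFinD.
  apply: edist_fin; first by rewrite ltr_wpDl// mdist_ge0.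
  by rewrite ballEmdist/= ltrDl.
apply: le_ereal_inf_tmp => _ [r [r0 xyr] <-].
by move: xyr; rewrite ballEmdist/= lee_fin => /ltW.
Qed.

Section EuclideanDistance.
Context {R : realType} {n : nat}.
Implicit Types x y z : 'rV[R]_n.

(* The norm [`|x|] that the library puts on ['rV[R]_n] is the sup norm. *)
Definition euclid_norm x : R := Num.sqrt (\sum_(i < n) x 0 i ^+ 2).

Definition euclid_dist x y : R := euclid_norm (x - y).

Lemma sum_sqr_ge0 x : 0 <= \sum_(i < n) x 0 i ^+ 2.
Proof. by apply: sumr_ge0 => i _; exact: sqr_ge0. Qed.

Lemma euclid_norm_sqr x : euclid_norm x ^+ 2 = \sum_(i < n) x 0 i ^+ 2.
Proof. by rewrite sqr_sqrtr// sum_sqr_ge0. Qed.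

Lemma euclid_norm_eq0 x : euclid_norm x = 0 -> x = 0.
Proof.
move=> x0; have /eqP : \sum_(i < n) x 0 i ^+ 2 = 0.
  by rewrite -euclid_norm_sqr x0 expr0n.
rewrite psumr_eq0; last by move=> i _; exact: sqr_ge0.
move=> /allP xi0; apply/rowP => i; rewrite mxE.
by have := xi0 i (mem_index_enum _); rewrite /= sqrf_eq0 => /eqP.
Qed.

Lemma euclid_cauchy_schwarz x y :
  \sum_(i < n) x 0 i * y 0 i <= euclid_norm x * euclid_norm y.
Proof.
have [x0|xN0] := eqVneq (euclid_norm x) 0.
  rewrite x0 mul0r (euclid_norm_eq0 x0) big1// => i _.
  by rewrite mxE mul0r.
have [y0|yN0] := eqVneq (euclid_norm y) 0.
  rewrite y0 mulr0 (euclid_norm_eq0 y0) big1// => i _.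
  by rewrite mxE mulr0.
set a := euclid_norm x; set b := euclid_norm y.
have a0 : 0 < a by rewrite lt_neqAle eq_sym xN0 sqrtr_ge0.
have b0 : 0 < b by rewrite lt_neqAle eq_sym yN0 sqrtr_ge0.
have : 0 <= \sum_(i < n) (b * x 0 i - a * y 0 i) ^+ 2.
  by apply: sumr_ge0 => i _; exact: sqr_ge0.
have -> : \sum_(i < n) (b * x 0 i - a * y 0 i) ^+ 2 =
    b ^+ 2 * (\sum_(i < n) x 0 i ^+ 2) + a ^+ 2 * (\sum_(i < n) y 0 i ^+ 2)
    - 2 * (a * b) * \sum_(i < n) x 0 i * y 0 i.
  rewrite !mulr_sumr -big_split/= -sumrB; apply: eq_bigr => i _.
  by ring.
rewrite -!euclid_norm_sqr -/a -/b.
set s := \sum_(i < n) _ => h.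
have ab0 : 0 < a * b by rewrite mulr_gt0.
have : 0 <= 2 * (a * b) * (a * b - s).
  by apply: le_trans h _; rewrite le_eqVlt; apply/orP; left; apply/eqP; ring.
by rewrite pmulr_rge0 ?subr_ge0// mulr_gt0.
Qed.

Lemma euclid_norm_triangle x y :
  euclid_norm (x + y) <= euclid_norm x + euclid_norm y.
Proof.
rewrite -(@ler_pXn2r _ 2)// ?nnegrE ?addr_ge0 ?sqrtr_ge0// sqrrD.
rewrite !euclid_norm_sqr.
have -> : \sum_(i < n) (x + y) 0 i ^+ 2 = \sum_(i < n) x 0 i ^+ 2
    + (\sum_(i < n) x 0 i * y 0 i) *+ 2 + \sum_(i < n) y 0 i ^+ 2.
  rewrite -sumrMnl -!big_split/=; apply: eq_bigr => i _.
  by rewrite mxE sqrrD.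
by rewrite lerD2r lerD2l lerMn2r/= euclid_cauchy_schwarz.
Qed.

Lemma euclid_dist_refl x : euclid_dist x x = 0.
Proof.
rewrite /euclid_dist subrr /euclid_norm big1 ?sqrtr0// => i _.
by rewrite mxE expr0n.
Qed.

Lemma euclid_dist_eq0 x y : euclid_dist x y = 0 -> x = y.
Proof. by move/euclid_norm_eq0/eqP; rewrite subr_eq0 => /eqP. Qed.

Lemma euclid_dist_sym x y : euclid_dist x y = euclid_dist y x.
Proof.
rewrite /euclid_dist /euclid_norm; congr Num.sqrt; apply: eq_bigr => i _.
by rewrite !mxE -sqrrN opprB.
Qed.

Lemma euclid_dist_triangle y x z :
  euclid_dist x z <= euclid_dist x y + euclid_dist y z.
Proof.
by apply: le_trans (euclid_norm_triangle _ _); rewrite addrA subrK.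
Qed.

End EuclideanDistance.

(* A new record rather than a sigma type over ['rV[R]_n], so that the topology
   and the distance come from the Euclidean metric and are not inherited from
   the sup norm. *)
Record unit_ball (R : realType) (n : nat) := UnitBall {
  ball_point :> 'rV[R]_n ;
  ball_pointP : \sum_(i < n) ball_point 0 i ^+ 2 <= 1 }.

HB.instance Definition _ (R : realType) (n : nat) :=
  [isSub for @ball_point R n].
HB.instance Definition _ (R : realType) (n : nat) :=
  [Choice of unit_ball R n by <:].

Section UnitBallMetric.
Context (R : realType) (n : nat).

Definition unit_ball_dist (x y : unit_ball R n) : R :=
  euclid_dist (ball_point x) (ball_point y).

Let dist_refl x : unit_ball_dist x x = 0.
Proof. exact: euclid_dist_refl. Qed.

Let dist_eq0 x y : unit_ball_dist x y = 0 -> x = y.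
Proof. by move/euclid_dist_eq0/val_inj. Qed.

Let dist_sym x y : unit_ball_dist x y = unit_ball_dist y x.
Proof. exact: euclid_dist_sym. Qed.

Let dist_triangle y x z :
  unit_ball_dist x z <= unit_ball_dist x y + unit_ball_dist y z.
Proof. exact: euclid_dist_triangle. Qed.

HB.instance Definition _ := isMetric.Build R (unit_ball R n)
  dist_refl dist_eq0 dist_sym dist_triangle.

End UnitBallMetric.

(* max (sup_(a in A) d(a, B), sup_(b in B) d(b, A)), in the extended reals;
   used below only for nonempty [A] and [B], where it is nonnegative. *)
Definition hausdorff_dist (R : realType) (Z : metricType R) (A B : set Z)
    : \bar R :=
  maxe (ereal_sup [set edist_inf B a | a in A])
       (ereal_sup [set edist_inf A b | b in B]).

Definition isometric_embedding (R : realType) (X Z : metricType R)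
    (f : X -> Z) : Prop :=
  forall x x', mdist (f x) (f x') = mdist x x'.

Definition gh_dist (R : realType) (X Y : metricType R) : \bar R :=
  ereal_inf [set d | exists (Z : metricType R) (phi : X -> Z) (psi : Y -> Z),
    [/\ isometric_embedding phi, isometric_embedding psi &
        d = hausdorff_dist (range phi) (range psi)]].

Definition covering_radius (R : realType) (X : metricType R) (m : nat)
    : \bar R :=
  ereal_inf [set hausdorff_dist P [set: X] | P in
    [set P : set X | P !=set0 /\ (P #<= `I_m)%card]].

(* Main.v *)
Require Import Defs.
From mathcomp Require Import all_boot all_order all_algebra.
From mathcomp Require Import all_classical all_reals all_analysis.
From mathcomp Require Import lra zify.
Import Order.TTheory GRing.Theory Num.Theory.
Import numFieldNormedType.Exports.

Set Implicit Arguments.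
Unset Strict Implicit.
Unset Printing Implicit Defensive.

(** Let B^m and B^n sit isometrically in Z at Hausdorff distance less than r,
    and let P be a set of at most m points of B^n such that every point of B^n is
    within rho of P. Give a unit vector x of R^m the colour p in P if x is
    r-close in Z to some y in B^n with |y - p| < rho. These are m colours on the
    sphere S^(m-1), and two points of the same colour are less than
    r + rho + rho + r apart. The Lyusternik-Schnirelmann theorem says that m
    colours cannot avoid pairs of equal colour at distance arbitrarily close
    to 2, so r + rho >= 1 ([one_le_hausdorff_add_covering]). The colouring is
    arbitrary, with no closedness of the colour classes, hence the need for the
    approximate form [lyusternik_schnirelmann].

    That theorem is deduced from a version of Tucker's lemma. If no two points of
    the same colour are nearly antipodal, then a point x and its antipode have
    different colours; label x by the smaller of the two colours, with a sign
    telling which of x and -x carries it. The labels are antisymmetric, they use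
    only m - 1 absolute values, and nearby points never have opposite labels.
    [tucker_lemma] excludes this, by Fan's parity argument carried out with
    chains modulo 2 of ordered tuples of points.
    - Topological side: there are chains h_0, ..., h_(m-1) made of small
      simplices, where h_0 is a point and the boundary of h_(i+1) is
      h_i + (antipode of h_i); think of h_i as a hemisphere of S^i. They come
      from the cross-polytope by coning ([boundary_hemisphere]), followed by
      barycentric subdivision ([boundary_subdiv], [diameter_subdiv]).
    - Combinatorial side: the number of simplices of h_i whose sorted labels
      alternate in sign has the same parity for all i, because the indicator of
      alternation is both the coboundary of the indicator of alternation with
      first sign + ([coboundary_sort]) and the sum of that indicator and its
      antipode ([pos_alternating_flip]). This number is 1 for h_0, so h_(m-1)
      contains a simplex with m labels of alternating signs, hence of distinct
      absolute values ([alternating_size]), but there are only m - 1 values. *)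

(** * Chains of ordered simplices modulo 2 *)

Section Chains.
Variable T : eqType.
Implicit Types (x : T) (s : seq T) (c : seq (seq T)) (phi psi : seq T -> bool).

(** A simplex is a sequence of vertices, in any order and possibly with
    repetitions, a chain is a list of simplices read modulo 2, and a cochain is
    a boolean function on simplices; [addb] is addition in F_2. *)
Definition pairing phi c : bool := \big[addb/false]_(s <- c) phi s.

(** Equality of the formal sums modulo 2 that two lists stand for. *)
Definition chain_eq c c' : Prop := forall phi, pairing phi c = pairing phi c'.

(** A single vertex has the empty simplex as its face: the complex is augmented,
    so that the boundary of a cone has the same form in every dimension. *)
Fixpoint faces s : seq (seq T) :=
  if s is x :: s' then s' :: map (cons x) (faces s') else [::].

Definition boundary c : seq (seq T) := flatten (map faces c).

Definition coboundary phi s : bool := pairing phi (faces s).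

Lemma pairing_cat phi c c' :
  pairing phi (c ++ c') = pairing phi c (+) pairing phi c'.
Proof. exact: big_cat. Qed.

Lemma pairing_map (U : Type) (f : U -> seq T) phi (c : seq U) :
  pairing phi (map f c) = \big[addb/false]_(s <- c) phi (f s).
Proof. exact: big_map. Qed.

Lemma pairing_flatten (f : seq T -> seq (seq T)) phi c :
  pairing phi (flatten (map f c)) = pairing (fun s => pairing phi (f s)) c.
Proof. by rewrite /pairing big_flatten/= big_map. Qed.

Lemma pairing_add phi psi c :
  pairing (fun s => phi s (+) psi s) c = pairing phi c (+) pairing psi c.
Proof. exact: big_split. Qed.

Lemma eq_pairing phi psi c :
  phi =1 psi -> pairing phi c = pairing psi c.
Proof. by move=> e; apply: eq_bigr. Qed.

Lemma pairing_boundary phi c :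
  pairing phi (boundary c) = pairing (coboundary phi) c.
Proof. exact: pairing_flatten. Qed.

Lemma coboundary_cons phi x s :
  coboundary phi (x :: s) = phi s (+) coboundary (fun t => phi (x :: t)) s.
Proof. by rewrite /coboundary/= /pairing big_cons big_map. Qed.

Lemma coboundary_coboundary phi s : coboundary (coboundary phi) s = false.
Proof.
elim: s phi => [|x s IH] phi; first by rewrite /coboundary /pairing big_nil.
rewrite coboundary_cons [X in _ (+) X](eq_pairing _ (coboundary_cons phi x)).
rewrite pairing_add -/(coboundary phi s).
by rewrite [X in _ (+) (_ (+) X)](IH (fun t => phi (x :: t))) addbF addbb.
Qed.

Definition cone x c : seq (seq T) := map (cons x) c.

Lemma boundary_cone x c :
  chain_eq (boundary (cone x c)) (c ++ cone x (boundary c)).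
Proof.
move=> phi; rewrite pairing_boundary pairing_cat /cone !pairing_map.
rewrite -[X in _ (+) X]/(pairing (fun s => phi (x :: s)) (boundary c)).
by rewrite pairing_boundary -pairing_add; apply: eq_bigr => s _;
  rewrite coboundary_cons.
Qed.

Lemma boundary_cone_cycle x c :
  chain_eq (boundary c) [::] -> chain_eq (boundary (cone x c)) c.
Proof.
move=> cycle phi; rewrite boundary_cone pairing_cat [X in _ (+) X]pairing_map.
rewrite -[X in _ (+) X]/(pairing (fun s => phi (x :: s)) _) cycle.
by rewrite /pairing big_nil addbF.
Qed.


Lemma mem_faces s t : t \in faces s -> (size t).+1 = size s /\ subseq t s.
Proof.
elim: s t => [//|x s IH] t; rewrite /= in_cons => /orP[/eqP -> |].
  by split=> //; apply: subseq_cons.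
by move=> /mapP[u /IH[su us] ->]; split; rewrite /= ?su// eqxx.
Qed.

End Chains.

(** * Hemispheres of the cross-polytope *)

Section Antipode.
Variables (T : eqType) (nu : T -> T) (e : nat -> T).
Hypothesis nuK : involutive nu.

Definition antipode_chain (c : seq (seq T)) := map (map nu) c.

(** With e_0, e_1, ... the basis vectors and nu the antipode, the i-th chain is
    the half of the boundary of the (i+1)-dimensional cross-polytope that
    contains e_i: the cone from e_i over the whole boundary one dimension
    below. *)
Fixpoint hemisphere (i : nat) : seq (seq T) :=
  if i is j.+1 then cone (e i) (hemisphere j ++ antipode_chain (hemisphere j))
  else [:: [:: e 0]].

Lemma faces_map (U V : eqType) (f : U -> V) s :
  faces (map f s) = map (map f) (faces s).
Proof.
by elim: s => //= x s ->; rewrite -!map_comp; congr (_ :: _); apply: eq_map.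
Qed.

Lemma boundary_antipode c :
  boundary (antipode_chain c) = antipode_chain (boundary c).
Proof.
rewrite /boundary /antipode_chain map_flatten -!map_comp; congr flatten.
by apply: eq_map => s /=; rewrite faces_map.
Qed.

Lemma antipode_chainK : involutive antipode_chain.
Proof. by apply: mapK; apply: mapK. Qed.

Lemma boundary_cat (c c' : seq (seq T)) :
  boundary (c ++ c') = boundary c ++ boundary c'.
Proof. by rewrite /boundary map_cat flatten_cat. Qed.

Lemma chain_eq_antipode c c' :
  chain_eq c c' -> chain_eq (antipode_chain c) (antipode_chain c').
Proof. by move=> cc' phi; rewrite !pairing_map; apply: cc'. Qed.

(** The sum of a hemisphere and its antipode is a cycle: by induction its
    boundary is a nu-invariant chain counted twice. So the cone over it has
    boundary equal to it. *)
Lemma boundary_hemisphere i :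
  chain_eq (boundary (hemisphere i.+1))
    (hemisphere i ++ antipode_chain (hemisphere i)).
Proof.
elim: i => [|i IH]; apply: boundary_cone_cycle => phi.
  by rewrite /pairing/= !big_cons !big_nil addbF addbb.
rewrite boundary_cat boundary_antipode pairing_cat IH.
rewrite (chain_eq_antipode IH) /antipode_chain map_cat -/antipode_chain.
rewrite !pairing_cat [map _ (map _ _)]antipode_chainK [X in _ (+) X]addbC.
by rewrite addbb /pairing big_nil.
Qed.

End Antipode.

(** * Barycentric subdivision *)

Section Subdivision.
Variables (T : eqType) (b : seq T -> T).
Implicit Types (s t : seq T) (c : seq (seq T)).

(** The cone from [b s] over the subdivided faces; for [n = size s] this is the
    barycentric subdivision when [b] is the barycenter. That it commutes with
    the boundary holds for any choice of [b]. *)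
Fixpoint subdiv (n : nat) (s : seq T) : seq (seq T) :=
  if n is n'.+1 then cone (b s) (flatten (map (subdiv n') (faces s)))
  else [:: s].

Definition subdiv_chain n c := flatten (map (subdiv n) c).

Lemma chain_eq_subdiv n c c' :
  chain_eq c c' -> chain_eq (subdiv_chain n c) (subdiv_chain n c').
Proof. by move=> cc' phi; rewrite !pairing_flatten; apply: cc'. Qed.

Lemma subdiv_chain_cat n c c' :
  subdiv_chain n (c ++ c') = subdiv_chain n c ++ subdiv_chain n c'.
Proof. by rewrite /subdiv_chain map_cat flatten_cat. Qed.

(** The subdivided faces form a cycle, because the coboundary squares to zero
    and subdivision commutes with the boundary one dimension below. *)
Lemma boundary_subdiv n s : size s = n.+1 ->
  chain_eq (boundary (subdiv n.+1 s)) (subdiv_chain n (faces s)).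
Proof.
elim: n s => [|n IH] s sn; apply: boundary_cone_cycle => phi.
  by case: s sn => [//|x [|//]] _; rewrite /pairing /= !big_nil.
rewrite pairing_boundary pairing_flatten [RHS]big_nil.
rewrite -(coboundary_coboundary (fun u => pairing phi (subdiv n u)) s).
apply: eq_big_seq => t /mem_faces[st _].
rewrite -pairing_boundary (IH t) ?pairing_flatten//.
by apply/eqP; rewrite -eqSS st sn.
Qed.

Lemma boundary_subdiv_chain n c : {in c, forall s, size s = n.+1} ->
  chain_eq (boundary (subdiv_chain n.+1 c)) (subdiv_chain n (boundary c)).
Proof.
move=> cn phi; rewrite pairing_boundary !pairing_flatten.
apply: eq_big_seq => s /cn sn.
by rewrite -pairing_boundary boundary_subdiv// pairing_flatten.
Qed.

Lemma size_subdiv n s : size s = n ->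
  {in subdiv n s, forall t, size t = n}.
Proof.
elim: n s => [|n IH] s sn t; first by rewrite inE => /eqP ->.
move=> /mapP[u /flatten_mapP[f /mem_faces[fs _] uf] ->] /=.
by rewrite (IH f)//; apply/eqP; rewrite -eqSS fs sn.
Qed.

(** Convex conditions on the vertices pass to the subdivision. This replaces the
    convex hull: half-spaces and balls are all that is needed. *)
Lemma mem_subdiv (P : T -> Prop) n s : size s = n ->
  (forall t, t != [::] -> (forall v, v \in t -> P v) -> P (b t)) ->
  (forall v, v \in s -> P v) ->
  forall t, t \in subdiv n s -> forall v, v \in t -> P v.
Proof.
move=> + Pb; elim: n s => [|n IH] s sn Ps t; first by rewrite inE => /eqP ->.
move=> /mapP[u /flatten_mapP[f /mem_faces[fs fsub] uf] ->] v.
rewrite in_cons => /orP[/eqP ->|]; first by apply: Pb; rewrite // -size_eq0 sn.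
apply: (IH f) => //; last by move=> w /(mem_subseq fsub); apply: Ps.
by apply/eqP; rewrite -eqSS fs sn.
Qed.

End Subdivision.

Section SubdivisionAntipode.
Variables (T : eqType) (b : seq T -> T) (nu : T -> T).
Hypothesis b_nu : forall s, b (map nu s) = nu (b s).

Lemma subdiv_map n s : subdiv b n (map nu s) = map (map nu) (subdiv b n s).
Proof.
elim: n s => [//|n IH] s.
rewrite /= b_nu faces_map /cone.
have -> : flatten (map (subdiv b n) (map (map nu) (faces s))) =
    map (map nu) (flatten (map (subdiv b n) (faces s))).
  rewrite map_flatten -!map_comp; congr flatten.
  by apply: eq_map => t; exact: IH.
by rewrite -!map_comp.
Qed.

Lemma subdiv_chain_antipode n c :
  subdiv_chain b n (antipode_chain nu c) =
  antipode_chain nu (subdiv_chain b n c).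
Proof.
rewrite /subdiv_chain /antipode_chain map_flatten -!map_comp; congr flatten.
by apply: eq_map => s /=; rewrite subdiv_map.
Qed.

End SubdivisionAntipode.

(** * The lemmas of Fan and Tucker *)

Section Fan.

(** The signed labels +j and -j are the natural numbers [j.*2] and [j.*2.+1], in
    some order: the absolute value is the half and the sign is the parity. The
    order of the natural numbers then refines that of absolute values. *)
Definition opposite_sign (x y : nat) : bool := odd x != odd y.

Definition alternating (l : seq nat) : bool := sorted opposite_sign l.

(** If a is the sign, seen as a 0-cochain, then [alternating] is the cup power
    (delta a)^i in degree i and [pos_alternating] is the cup product of a
    with (delta a)^i, so that its coboundary is (delta a)^(i+1). *)
Definition pos_alternating (l : seq nat) : bool :=
  odd (head 0 l) && alternating l.

(** Deleting a vertex other than the first one, [x]: the alternating faces cancel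
    in pairs except for what remains after deleting [x] itself, since [path] is
    a cocycle. *)
Lemma coboundary_path (x y : nat) l :
  coboundary (path opposite_sign x) (y :: l) = path opposite_sign y l.
Proof.
elim: l x y => [|z l IH] x y.
  by rewrite /coboundary /pairing /= big_seq1.
rewrite coboundary_cons.
have -> : coboundary (fun t => path opposite_sign x (y :: t)) (z :: l) =
    opposite_sign x y && path opposite_sign z l.
  by rewrite -(IH y) /=; case: (opposite_sign x y) => //=;
    apply: big1_eq.
rewrite /= /opposite_sign.
by case: (odd x); case: (odd y); case: (odd z); case: (path _ _ _).
Qed.

Lemma coboundary_pos_alternating l : 1 < size l ->
  coboundary pos_alternating l = alternating l.
Proof.
case: l => [//|x [//|y l]] _; rewrite coboundary_cons.
have -> : coboundary (fun t => pos_alternating (x :: t)) (y :: l) =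
    odd x && path opposite_sign y l.
  by rewrite -(coboundary_path x) /pos_alternating /=; case: (odd x) => //=;
    apply: big1_eq.
rewrite /pos_alternating /= /opposite_sign.
by case: (odd x); case: (odd y); case: (path _ _ _).
Qed.

Definition flip (k : nat) : nat := if odd k then k.-1 else k.+1.

Lemma odd_flip k : odd (flip k) = ~~ odd k.
Proof. by rewrite /flip; case: ifP; lia. Qed.

Lemma half_flip k : (flip k)./2 = k./2.
Proof. by rewrite /flip; case: ifP; lia. Qed.

Lemma pos_alternating_flip l : l != [::] ->
  pos_alternating l (+) pos_alternating (map flip l) = alternating l.
Proof.
case: l => [//|x l] _; rewrite /pos_alternating /= odd_flip.
have -> : path opposite_sign (flip x) (map flip l) = path opposite_sign x l.
  rewrite path_map; apply: eq_path => y z.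
  by rewrite /= /opposite_sign !odd_flip; case: (odd y); case: (odd z).
by case: (odd x); rewrite ?addbF.
Qed.

(** A cochain that ignores the order of the vertices need not distinguish the
    deletion of a position from the deletion of a value. *)
Lemma pairing_faces_rem (T : eqType) (phi : seq T -> bool) s :
  (forall u v, perm_eq u v -> phi u = phi v) ->
  pairing phi (faces s) = \big[addb/false]_(x <- s) phi (rem x s).
Proof.
elim: s phi => [|x s IH] phi phi_perm; first by rewrite /pairing !big_nil.
rewrite -/(coboundary _ _) coboundary_cons big_cons /= eqxx; congr (_ (+) _).
rewrite [LHS](IH (fun t => phi (x :: t))); last first.
  by move=> u v uv; apply: phi_perm; rewrite perm_cons.
apply: eq_big_seq => y ys; apply: phi_perm.
case: eqP => [xy|_]; last exact: perm_refl.
by rewrite xy perm_sym; apply: perm_to_rem.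
Qed.

Lemma coboundary_perm (T : eqType) (phi : seq T -> bool) s t :
  (forall u v, perm_eq u v -> phi u = phi v) ->
  perm_eq s t -> coboundary phi s = coboundary phi t.
Proof.
move=> phi_perm st; rewrite /coboundary !pairing_faces_rem//.
rewrite (perm_big _ st); apply: eq_big_seq => x xt; apply: phi_perm.
have xs : x \in s by rewrite (perm_mem st).
rewrite -(perm_cons x) -(permPl (perm_to_rem xs)) (permPl st).
exact: perm_to_rem.
Qed.

Lemma sort_leq_perm s t : perm_eq s t -> sort leq s = sort leq t.
Proof.
move/perm_sortP => -> //.
- exact: leq_total.
- exact: leq_trans.
- exact: anti_leq.
Qed.

(** Sorting makes the cup product cochains independent of the order of the
    vertices. For a sorted sequence the faces are sorted too, and the formula is
    the one without sorting. *)
Lemma coboundary_sort s : 1 < size s ->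
  coboundary (pos_alternating \o sort leq) s = alternating (sort leq s).
Proof.
move=> s2; have s_sort : perm_eq s (sort leq s) by rewrite perm_sym perm_sort.
rewrite (coboundary_perm _ s_sort); last first.
  by move=> u v uv /=; rewrite (sort_leq_perm uv).
rewrite -coboundary_pos_alternating ?size_sort//.
have : sorted leq (sort leq s) by exact/sort_sorted/leq_total.
move: (sort leq s) => l sl; apply: eq_big_seq => t tl /=.
have [_ ts] := mem_faces tl.
by rewrite (sorted_sort leq_trans (subseq_sorted leq_trans ts sl)).
Qed.

(** Flipping all signs preserves the order, unless opposite labels both occur,
    whose order it reverses. *)
Lemma sort_flip l :
  {in l &, forall x y, x./2 = y./2 -> x = y} ->
  sort leq (map flip l) = map flip (sort leq l).
Proof.
move=> inj; apply: (sorted_eq leq_trans anti_leq).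
- exact/sort_sorted/leq_total.
- have := sort_sorted leq_total l.
  apply: (homo_sorted_in (P := mem l)) => [x y xl yl xy|]; last first.
    by apply/allP => x; rewrite mem_sort.
  have [<-//|half_xy] := eqVneq x y.
  have : x./2 != y./2 by apply: contra half_xy => /eqP/(inj _ _ xl yl) ->.
  have := half_leq xy.
  have := half_flip x; have := half_flip y.
  by lia.
- by rewrite perm_sort perm_map// perm_sym perm_sort.
Qed.

Variables (T : eqType) (nu : T -> T) (label : T -> nat).

(** The labelling is antisymmetric at the vertices, and no two vertices have
    opposite labels. *)
Definition tucker_simplex (s : seq T) : Prop :=
  {in s, forall v, label (nu v) = flip (label v)} /\
  {in s &, forall u v, (label u)./2 = (label v)./2 -> label u = label v}.

(** The pairing of the alternation cochain with [h i] does not depend on [i], by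
    Stokes' formula applied to [pos_alternating], and it is 1 for the single
    vertex of [h 0]. *)
Lemma exists_alternating_simplex (h : nat -> seq (seq T)) (v0 : T) d :
  h 0 = [:: [:: v0]] ->
  (forall i, i < d ->
    chain_eq (boundary (h i.+1)) (h i ++ antipode_chain nu (h i))) ->
  (forall i s, i <= d -> s \in h i -> size s = i.+1 /\ tucker_simplex s) ->
  exists2 s, s \in h d & alternating (sort leq (map label s)).
Proof.
move=> h0 bd_h h_good.
pose alt s := alternating (sort leq (map label s)).
suff alt_h i : i <= d -> pairing alt (h i) = true.
  have := alt_h d (leqnn d).
  have [/hasP[s sh alts] _|] := boolP (has alt (h d)).
    by exists s.
  move=> /hasPn noalt; rewrite /pairing big1_seq// => s /= /noalt.
  by move/negbTE.
elim: i => [_|i IH id]; first by rewrite h0 /pairing big_seq1.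
rewrite -(IH (ltnW id)).
pose phi s := pos_alternating (sort leq (map label s)).
have -> : pairing alt (h i.+1) = pairing (coboundary phi) (h i.+1).
  apply: eq_big_seq => s /(h_good _ _ id)[si _].
  rewrite /alt -coboundary_sort ?size_map ?si//.
  by rewrite /coboundary faces_map pairing_map.
rewrite -pairing_boundary bd_h// pairing_cat pairing_map -pairing_add.
apply: eq_big_seq => s /(h_good _ _ (ltnW id))[si [label_nu label_inj]].
rewrite /phi /alt -map_comp.
have /eq_in_map -> : {in s, label \o nu =1 flip \o label} by move=> v /label_nu.
rewrite map_comp sort_flip; last first.
  by move=> _ _ /mapP[u us ->] /mapP[v vs ->]; exact: label_inj.
by apply: pos_alternating_flip; rewrite -size_eq0 size_sort size_map si.
Qed.

(** Sorted neighbours of different sign have different absolute values, since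
    opposite labels do not occur. *)
Lemma alternating_size d l :
  {in l &, forall x y, x./2 = y./2 -> x = y} ->
  {in l, forall x, x./2 < d} ->
  alternating (sort leq l) -> size l <= d.
Proof.
move=> inj bound alt; rewrite -(size_sort leq) -(size_map half) -(size_iota 0 d).
apply: uniq_leq_size; last first.
  by move=> _ /mapP[x xl ->]; rewrite mem_iota /= bound// -(mem_sort leq).
apply: (sorted_uniq ltn_trans ltnn).
have : sorted [rel x y | (x <= y) && opposite_sign x y] (sort leq l).
  by rewrite sorted_relI sort_sorted//; exact: leq_total.
apply: (homo_sorted_in (P := mem l)) => [x y xl yl|]; last first.
  by apply/allP => x; rewrite mem_sort.
move=> /andP[xy]; rewrite /opposite_sign ltn_neqAle half_leq// andbT.
by apply: contra => /eqP/(inj _ _ xl yl) ->.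
Qed.

(** The alternating simplex has [d.+1] labels, one more than the available
    absolute values. *)
Lemma tucker_lemma (h : nat -> seq (seq T)) (v0 : T) d :
  h 0 = [:: [:: v0]] ->
  (forall i, i < d ->
    chain_eq (boundary (h i.+1)) (h i ++ antipode_chain nu (h i))) ->
  (forall i s, i <= d -> s \in h i -> size s = i.+1 /\ tucker_simplex s) ->
  ~ (forall s, s \in h d -> {in s, forall v, (label v)./2 < d}).
Proof.
move=> h0 bd_h h_good bound.
have [s sh alts] := exists_alternating_simplex h0 bd_h h_good.
have [sd [_ inj]] := h_good _ _ (leqnn d) sh.
suff : size (map label s) <= d by rewrite size_map sd ltnn.
apply: alternating_size alts.
- by move=> _ _ /mapP[u us ->] /mapP[v vs ->]; exact: inj.
- by move=> _ /mapP[v vs ->]; exact: bound vs.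
Qed.

End Fan.

(** * Fine hemispheres in Euclidean space *)

Section Geometry.
Local Open Scope ring_scope.
Variables (R : realType) (d : nat).
Let V := 'rV[R]_d.+1.
Implicit Types (a p u v x y : V) (s t : seq V) (D r : R).

Definition dot a v : R := \sum_i a 0 i * v 0 i.

Lemma dotDl a b v : dot (a + b) v = dot a v + dot b v.
Proof. by rewrite -big_split; apply: eq_bigr => i _; rewrite mxE mulrDl. Qed.

Lemma dotDr a u v : dot a (u + v) = dot a u + dot a v.
Proof. by rewrite -big_split; apply: eq_bigr => i _; rewrite mxE mulrDr. Qed.

Lemma dotZr a k v : dot a (k *: v) = k * dot a v.
Proof. by rewrite mulr_sumr; apply: eq_bigr => i _; rewrite mxE mulrCA. Qed.

Lemma dotNr a v : dot a (- v) = - dot a v.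
Proof. by rewrite -scaleN1r dotZr mulN1r. Qed.

Lemma dotNl a v : dot (- a) v = - dot a v.
Proof. by rewrite -sumrN; apply: eq_bigr => i _; rewrite mxE mulNr. Qed.

Lemma dot_sumr a s : dot a (\sum_(v <- s) v) = \sum_(v <- s) dot a v.
Proof.
apply: (big_morph (dot a) (dotDr a)).
by rewrite /dot big1// => i _; rewrite mxE mulr0.
Qed.

Lemma euclid_normZ k v : euclid_norm (k *: v) = `|k| * euclid_norm v.
Proof.
rewrite /euclid_norm -sqrtr_sqr -sqrtrM ?sqr_ge0// mulr_sumr.
by congr Num.sqrt; apply: eq_bigr => i _; rewrite mxE exprMn.
Qed.

Lemma euclid_normN v : euclid_norm (- v) = euclid_norm v.
Proof. by rewrite -scaleN1r euclid_normZ normrN1 mul1r. Qed.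

Lemma euclid_norm0 : euclid_norm (0 : V) = 0.
Proof. by rewrite -(scale0r 0) euclid_normZ normr0 mul0r. Qed.

Lemma euclid_norm_ge0 v : 0 <= euclid_norm v.
Proof. exact: sqrtr_ge0. Qed.

Lemma euclid_norm_sum (F : V -> V) s :
  euclid_norm (\sum_(v <- s) F v) <= \sum_(v <- s) euclid_norm (F v).
Proof.
elim: s => [|v s IH]; first by rewrite !big_nil euclid_norm0.
rewrite !big_cons; apply: le_trans (euclid_norm_triangle _ _) _.
by rewrite lerD2l.
Qed.

Lemma sum_seq_le (F : V -> R) s D : {in s, forall v, F v <= D} ->
  \sum_(v <- s) F v <= (size s)%:R * D.
Proof.
move=> FD; rewrite big_seq; apply: (@le_trans _ _ (\sum_(v <- s | v \in s) D)).
  exact: ler_sum.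
by rewrite -big_seq big_const_seq count_predT iter_addr_0 mulr_natl.
Qed.

Definition barycenter s : V := (size s)%:R^-1 *: \sum_(v <- s) v.

Lemma barycenterN s : barycenter (map -%R s) = - barycenter s.
Proof. by rewrite /barycenter size_map big_map sumrN scalerN. Qed.

Lemma barycenter1 v : barycenter [:: v] = v.
Proof. by rewrite /barycenter big_seq1 invr1 scale1r. Qed.

Lemma dot_barycenter a r s : s != [::] ->
  (forall v, v \in s -> dot a v = r) -> dot a (barycenter s) = r.
Proof.
move=> s0 ar; rewrite dotZr dot_sumr (eq_big_seq (fun=> r))//.
rewrite big_const_seq count_predT iter_addr_0 -[r *+ _]mulr_natl mulKf//.
by rewrite pnatr_eq0 size_eq0.
Qed.

Lemma sub_barycenter p s : s != [::] ->
  p - barycenter s = (size s)%:R^-1 *: \sum_(v <- s) (p - v).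
Proof.
move=> s0; rewrite sumrB scalerBr; congr (_ - _).
rewrite big_const_seq count_predT iter_addr_0 -[p *+ _]scaler_nat.
by rewrite scalerA mulVf ?scale1r// pnatr_eq0 size_eq0.
Qed.

Lemma dist_barycenter p r s : s != [::] ->
  (forall v, v \in s -> euclid_dist p v <= r) ->
  euclid_dist p (barycenter s) <= r.
Proof.
move=> s0 pr; have n0 : 0 < (size s)%:R :> R by rewrite ltr0n lt0n size_eq0.
rewrite /euclid_dist sub_barycenter// euclid_normZ ger0_norm ?invr_ge0 ?ler0n//.
rewrite ler_pdivrMl//; apply: le_trans (euclid_norm_sum _ _) _.
exact: sum_seq_le.
Qed.

(** Of the [size s] vectors averaged in [v - barycenter s], one is zero. *)
Lemma dist_vertex_barycenter D s v : v \in s ->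
  {in s &, forall x y, euclid_dist x y <= D} ->
  euclid_dist v (barycenter s) <= (1 - (size s)%:R^-1) * D.
Proof.
move=> vs sD; have s0 : s != [::] by apply: contraTneq vs => ->.
have n0 : 0 < (size s)%:R :> R by rewrite ltr0n lt0n size_eq0.
rewrite /euclid_dist sub_barycenter// euclid_normZ ger0_norm ?invr_ge0 ?ler0n//.
rewrite ler_pdivrMl// mulrA mulrBr mulr1 mulfV ?gt_eqF//.
apply: le_trans (euclid_norm_sum _ _) _.
rewrite (perm_big _ (perm_to_rem vs)) big_cons /= subrr euclid_norm0 add0r.
have -> : (size s)%:R - 1 = (size (rem v s))%:R :> R.
  by rewrite size_rem// -subn1 natrB// lt0n size_eq0.
by apply: sum_seq_le => w /mem_rem ws; exact: sD.
Qed.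

(** The classical mesh estimate. The bound [N] on the number of vertices is
    separate from [n] because the factor must not change in the induction on faces. *)
Lemma diameter_subdiv N D n s : 0 <= D -> (n <= N)%N -> size s = n ->
  {in s &, forall x y, euclid_dist x y <= D} ->
  forall t, t \in subdiv barycenter n s ->
  {in t &, forall x y, euclid_dist x y <= (1 - N%:R^-1) * D}.
Proof.
move=> D0; elim: n s => [|n IH] s nN sn sD t.
  by move: sn => /size0nil ->; rewrite inE => /eqP ->.
have N0 : 0 < N%:R :> R by rewrite ltr0n (leq_trans _ nN).
move=> /mapP[u /flatten_mapP[f /mem_faces[fs /mem_subseq fsub] uf] ->].
have fn : size f = n by apply/eqP; rewrite -eqSS fs sn.
have near w : w \in u -> euclid_dist w (barycenter s) <= (1 - N%:R^-1) * D.
  move=> wu; rewrite euclid_dist_sym.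
  pose P v := euclid_dist (barycenter s) v <= (1 - N%:R^-1) * D.
  apply: (mem_subdiv (P := P) fn _ _ uf wu) => [r r0 rP|v /fsub vs].
    exact: dist_barycenter.
  rewrite /P euclid_dist_sym; apply: le_trans (dist_vertex_barycenter vs sD) _.
  rewrite ler_wpM2r// lerD2l lerN2 lef_pV2 ?posrE ?sn//.
  by rewrite ler_nat.
move=> x y; rewrite !in_cons => /orP[/eqP ->|xu] /orP[/eqP ->|yu].
- by rewrite euclid_dist_refl mulr_ge0// subr_ge0 invf_le1// ler1n -(ltr0n R).
- by rewrite euclid_dist_sym; exact: near.
- exact: near.
- apply: (IH f) uf _ _ xu yu => //; first exact: ltnW.
  by move=> v w /fsub vs /fsub ws; exact: sD.
Qed.

(** Indexed by natural numbers because [hemisphere] takes a sequence of vertices;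
    distinct [i <= d] give the distinct basis vectors. *)
Definition vertex (i : nat) : V := delta_mx 0 (inord i).

Definition supported (i : nat) v : Prop :=
  forall j : 'I_d.+1, (i < j)%N -> v 0 j = 0.

Lemma vertex_norm i : euclid_norm (vertex i) = 1.
Proof.
rewrite /euclid_norm (bigD1 (inord i))//= big1 => [|j ji].
  by rewrite mxE !eqxx expr1n addr0 sqrtr1.
by rewrite mxE (negbTE ji) andbF expr0n.
Qed.

Lemma dot_vertexr a i : dot a (vertex i) = a 0 (inord i).
Proof.
rewrite /dot (bigD1 (inord i))//= big1 => [|j ji].
  by rewrite mxE !eqxx mulr1 addr0.
by rewrite mxE (negbTE ji) andbF mulr0.
Qed.

Lemma dot_vertexl i v : dot (vertex i) v = v 0 (inord i).
Proof. by rewrite -dot_vertexr /dot; apply: eq_bigr => j _; rewrite mulrC. Qed.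

Lemma supported_vertex i : (i <= d)%N -> supported i (vertex i).
Proof.
move=> id j ij; rewrite mxE; have /negbTE -> : j != inord i.
  by rewrite -val_eqE /= inordK// gtn_eqF.
by rewrite andbF.
Qed.

(** A simplex of the cross-polytope lies in a hyperplane [dot a v = 1] with [a] a
    vector of signs. This keeps it away from the origin, and the property
    survives subdivision, unlike [euclid_norm v = 1]. *)
Lemma mem_hemisphere i s : (i <= d)%N ->
  s \in hemisphere -%R vertex i ->
  [/\ size s = i.+1,
      {in s, forall v, euclid_norm v = 1 /\ supported i v} &
      exists a, [/\ euclid_norm a <= i.+1%:R, supported i a &
        {in s, forall v, dot a v = 1}]].
Proof.
elim: i s => [|i IH] s id.
  rewrite inE => /eqP ->; split=> // [v|].
    rewrite inE => /eqP ->; rewrite vertex_norm; split=> //.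
    exact: supported_vertex.
  exists (vertex 0); split; [by rewrite vertex_norm|exact: supported_vertex|].
  by move=> v; rewrite inE => /eqP ->; rewrite dot_vertexr mxE !eqxx.
move=> /mapP[t tP ->].
have {tP} [tsize tnorm [a [anorm asupp at1]]] : [/\ size t = i.+1,
      {in t, forall v, euclid_norm v = 1 /\ supported i v} &
      exists a, [/\ euclid_norm a <= i.+1%:R, supported i a &
        {in t, forall v, dot a v = 1}]].
  move: tP; rewrite mem_cat => /orP[/IH|]; first by apply; exact: ltnW.
  move=> /mapP[u /IH[]]; first exact: ltnW.
  move=> usize unorm [a [anorm asupp au1]] ->; split.
  - by rewrite size_map.
  - move=> _ /mapP[v /unorm[v1 vs] ->]; rewrite euclid_normN; split=> //.
    by move=> j /vs vj; rewrite mxE vj oppr0.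
  - exists (- a); split; first by rewrite euclid_normN.
      by move=> j /asupp aj; rewrite mxE aj oppr0.
    by move=> _ /mapP[v /au1 av ->]; rewrite dotNl dotNr opprK.
have ii : (i < (inord i.+1 : 'I_d.+1))%N by rewrite inordK.
have suppW v : supported i v -> supported i.+1 v.
  by move=> vs j /ltnW; exact: vs.
split; first by rewrite /= tsize.
  move=> v; rewrite inE => /orP[/eqP ->|/tnorm[v1 /suppW //]].
  by rewrite vertex_norm; split=> //; exact: supported_vertex.
exists (a + vertex i.+1); split.
- apply: le_trans (euclid_norm_triangle _ _) _.
  by rewrite vertex_norm -[in leRHS]natr1 lerD2r.
- move=> j ij; rewrite mxE (suppW _ asupp)// add0r.
  by rewrite supported_vertex.
- move=> v; rewrite inE => /orP[/eqP ->|vt]; rewrite dotDl dot_vertexl.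
    by rewrite dot_vertexr asupp// add0r mxE !eqxx.
  by rewrite at1// (tnorm _ vt).2// addr0.
Qed.

Definition fine_hemisphere k i : seq (seq V) :=
  iter k (subdiv_chain barycenter i.+1) (hemisphere -%R vertex i).

Lemma fine_hemisphere0 k : fine_hemisphere k 0 = [:: [:: vertex 0]].
Proof.
elim: k => //= k; rewrite /fine_hemisphere => /= ->.
by rewrite /subdiv_chain /= barycenter1.
Qed.

Lemma mem_fine_hemisphere k i s : (i <= d)%N -> s \in fine_hemisphere k i ->
  [/\ size s = i.+1,
      exists2 a, euclid_norm a <= d.+1%:R & {in s, forall v, dot a v = 1} &
      {in s &, forall x y, euclid_dist x y <= (1 - d.+1%:R^-1) ^+ k * 2}].
Proof.
move=> id; elim: k s => [|k IH] s.
  move=> /(mem_hemisphere id)[ssize snorm [a [anorm _ as1]]]; split=> //.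
    by exists a => //; apply: le_trans anorm _; rewrite ler_nat.
  move=> x y /snorm[x1 _] /snorm[y1 _]; rewrite expr0 mul1r.
  by apply: le_trans (euclid_norm_triangle _ _) _; rewrite euclid_normN x1 y1.
move=> /flatten_mapP[t /IH[tsize [a anorm at1] tdist] ts].
split; first exact: size_subdiv ts.
  exists a => // v.
  apply: (mem_subdiv (P := fun v => dot a v = 1) tsize _ at1 ts) => r r0.
  exact: dot_barycenter.
rewrite exprS -mulrA; apply: diameter_subdiv ts => //.
by rewrite mulr_ge0// exprn_ge0// subr_ge0 invf_le1// ?ler1n.
Qed.

Lemma boundary_fine_hemisphere k i : (i < d)%N ->
  chain_eq (boundary (fine_hemisphere k i.+1))
    (fine_hemisphere k i ++ antipode_chain -%R (fine_hemisphere k i)).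
Proof.
move=> id; elim: k => [|k IH] phi.
  exact: (boundary_hemisphere _ (@opprK V)).
rewrite /fine_hemisphere iterS -/(fine_hemisphere k i.+1) boundary_subdiv_chain.
  by rewrite (chain_eq_subdiv _ _ IH) subdiv_chain_cat
    (subdiv_chain_antipode barycenterN).
by move=> s /mem_fine_hemisphere[].
Qed.

End Geometry.

(** * The Lyusternik-Schnirelmann theorem *)

Section LyusternikSchnirelmann.
Local Open Scope ring_scope.
Variables (R : realType) (d : nat).
Let V := 'rV[R]_d.+1.
Implicit Types (u v w x y : V).

Definition direction v : V := (euclid_norm v)^-1 *: v.

Lemma directionN v : direction (- v) = - direction v.
Proof. by rewrite /direction euclid_normN scalerN. Qed.

Lemma direction_norm v : 0 < euclid_norm v -> euclid_norm (direction v) = 1.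
Proof.
move=> v0; rewrite euclid_normZ ger0_norm ?invr_ge0 ?euclid_norm_ge0//.
by rewrite mulVf ?gt_eqF.
Qed.

Lemma norm_dist_le x y : `|euclid_norm x - euclid_norm y| <= euclid_dist x y.
Proof.
have := euclid_norm_triangle (x - y) y; have := euclid_norm_triangle (y - x) x.
rewrite !subrK -!/(euclid_dist _ _) euclid_dist_sym ler_norml => hx hy.
by apply/andP; split; lra.
Qed.

(** Radial projection to the sphere is Lipschitz away from the origin. *)
Lemma dist_direction x y : 0 < euclid_norm x -> 0 < euclid_norm y ->
  euclid_norm x * euclid_dist (direction x) (direction y) <=
  2 * euclid_dist x y.
Proof.
move=> x0 y0; rewrite -[X in X * _ <= _]ger0_norm ?euclid_norm_ge0//.
rewrite -euclid_normZ.
have -> : euclid_norm x *: (direction x - direction y) =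
    (x - y) + ((euclid_norm y - euclid_norm x) / euclid_norm y) *: y.
  rewrite /direction scalerBr !scalerA mulfV ?gt_eqF// scale1r.
  rewrite mulrBl mulfV ?gt_eqF//.
  by rewrite scalerBl scale1r addrA subrK.
apply: le_trans (euclid_norm_triangle _ _) _.
rewrite euclid_normZ normrM normfV (ger0_norm (euclid_norm_ge0 y)).
rewrite mulfVK ?gt_eqF// mulr_natl mulr2n lerD2l.
by rewrite [leRHS]euclid_dist_sym norm_dist_le.
Qed.

Lemma norm_ge_of_dot (a v : V) c : 0 < c -> euclid_norm a <= c -> dot a v = 1 ->
  c^-1 <= euclid_norm v.
Proof.
move=> c0 ac av; rewrite -[leLHS]mul1r ler_pdivrMr// mulrC -av.
apply: le_trans (euclid_cauchy_schwarz a v) _.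
by rewrite ler_wpM2r// euclid_norm_ge0.
Qed.

Lemma antipodal_dist u w : euclid_norm u = 1 ->
  2 - euclid_dist u w <= euclid_dist u (- w).
Proof.
move=> u1; rewrite lerBlDl /euclid_dist opprK.
apply: le_trans (euclid_norm_triangle _ _).
have -> : u - w + (u + w) = 2%:R *: u.
  by rewrite scaler_nat mulr2n addrACA addNr addr0.
by rewrite euclid_normZ u1 mulr1 normr_nat.
Qed.

Lemma exists_small_expr (q c : R) : 0 <= q < 1 -> 0 < c -> exists k, q ^+ k < c.
Proof.
move=> /andP[q0 q1] c0.
have : ((GRing.exp q : R^nat) @ \oo --> (0 : R))%classic.
  by apply: cvg_expr; rewrite ger0_norm.
move=> /cvgrPdist_lt/(_ c c0)[k _ /(_ k (leqnn k))].
by rewrite /= sub0r normrN ger0_norm ?exprn_ge0//; exists k.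
Qed.

(** A discrete form, for [d.+1] arbitrary colour classes on the sphere of
    dimension [d]. The labels of Tucker's lemma compare the colours of a point
    and of its antipode; their absolute value is the smaller of two different
    colours, hence less than [d]. *)
Lemma lyusternik_schnirelmann (f : V -> nat) (eps : R) : 0 < eps ->
  (forall v, euclid_norm v = 1 -> (f v < d.+1)%N) ->
  exists x y, [/\ euclid_norm x = 1, euclid_norm y = 1, f x = f y &
    2 - eps < euclid_dist x y].
Proof.
move=> eps0 f_lt; apply: contrapT => no_pair.
have f_sep x y : euclid_norm x = 1 -> euclid_norm y = 1 ->
    2 - eps < euclid_dist x y -> f x <> f y.
  by move=> x1 y1 xy fxy; apply: no_pair; exists x, y.
have f_sepN x : euclid_norm x = 1 -> f x <> f (- x).
  move=> x1; apply: f_sep => //; first by rewrite euclid_normN.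
  apply: lt_le_trans (antipodal_dist _ x1).
  by rewrite euclid_dist_refl subr0 ltrBlDr ltrDl.
pose label v := let u := direction v in
  if (f u < f (- u))%N then (f u).*2 else (f (- u)).*2.+1.
pose q : R := 1 - d.+1%:R^-1.
have c0 : 0 < d.+1%:R :> R by rewrite ltr0n.
have q01 : 0 <= q < 1.
  by rewrite subr_ge0 invf_le1// ler1n ltrBlDr ltrDl invr_gt0 c0.
have [k qk] : exists k, q ^+ k < eps / (4 * d.+1%:R).
  by apply: exists_small_expr => //; rewrite divr_gt0// mulr_gt0.
(* The simplices have diameter at most 2 * q ^ k and norms at least 1 / d.+1, so
   that their projections to the sphere have diameter at most
   4 * d.+1 * q ^ k < eps. *)
have norm_pos i s : (i <= d)%N -> s \in fine_hemisphere R d k i ->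
    {in s, forall v, d.+1%:R^-1 <= euclid_norm v}.
  move=> id /(mem_fine_hemisphere id)[_ [a ad as1] _] v /as1.
  exact: norm_ge_of_dot.
have norm_gt0 i s : (i <= d)%N -> s \in fine_hemisphere R d k i ->
    {in s, forall v, 0 < euclid_norm v}.
  move=> id si v vs; apply: lt_le_trans (norm_pos _ _ id si v vs).
  by rewrite invr_gt0.
have close i s : (i <= d)%N -> s \in fine_hemisphere R d k i ->
    {in s &, forall v w, euclid_dist (direction v) (direction w) < eps}.
  move=> id si v w vs ws.
  have [v0 w0] := (norm_gt0 _ _ id si v vs, norm_gt0 _ _ id si w ws).
  have := dist_direction v0 w0.
  have [_ _ /(_ v w vs ws)] := mem_fine_hemisphere id si; rewrite -/q => vw.
  have := norm_pos _ _ id si v vs.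
  have := euclid_norm_ge0 (direction v - direction w).
  rewrite -/(euclid_dist _ _).
  move: vw qk; rewrite ltr_pdivlMr ?mulr_gt0//.
  set e := euclid_dist (direction v) _; set D := euclid_dist v w.
  set N := euclid_norm v; set Q := q ^+ k => vw Qe e0 vN hN.
  have : d.+1%:R^-1 * e <= 2 * (Q * 2).
    apply: le_trans (ler_wpM2r e0 vN) _; apply: le_trans hN _.
    by rewrite ler_pM2l.
  rewrite ler_pdivrMl// => h; apply: le_lt_trans h _; lra.
apply: (@tucker_lemma _ -%R label (fine_hemisphere R d k) (vertex R d 0) d).
- exact: fine_hemisphere0.
- by move=> i id; exact: boundary_fine_hemisphere.
- move=> i s id si; split; first by have [] := mem_fine_hemisphere id si.
  split=> [v vs|v w vs ws].
    have v0 := norm_gt0 _ _ id si v vs.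
    have := f_sepN _ (direction_norm v0).
    rewrite /label directionN opprK /flip.
    move: (f (direction v)) (f (- direction v)) => j j' jj'.
    by case: (ltngtP j j') => [||/jj'//] _; rewrite /= odd_double.
  (* If the labels of v and w were opposite, then v and -w would have the same
     colour, or -v and w; but both pairs are nearly antipodal. *)
  have v1 := direction_norm (norm_gt0 _ _ id si v vs).
  have w1 := direction_norm (norm_gt0 _ _ id si w ws).
  have vw := close _ _ id si v w vs ws.
  have far : 2 - eps < euclid_dist (direction v) (- direction w).
    by apply: lt_le_trans (antipodal_dist _ v1); rewrite ltrD2l ltrN2.
  have nw1 : euclid_norm (- direction w) = 1 by rewrite euclid_normN.
  have nv1 : euclid_norm (- direction v) = 1 by rewrite euclid_normN.
  have h1 := f_sep _ _ v1 nw1 far.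
  have h2 : f (- direction v) <> f (direction w).
    apply: f_sep => //; rewrite /euclid_dist -opprD euclid_normN.
    by move: far; rewrite /euclid_dist opprK.
  move: h1 h2; rewrite /label.
  move: (f (direction v)) (f (- direction v)).
  move: (f (direction w)) (f (- direction w)).
  by move=> b b' a a' ab' a'b; case: ifP => _; case: ifP => _; lia.
- move=> s si v vs.
  have v1 := direction_norm (norm_gt0 _ _ (leqnn d) si v vs).
  have := f_sepN _ v1; have := f_lt _ v1.
  have : euclid_norm (- direction v) = 1 by rewrite euclid_normN.
  move=> /f_lt; rewrite /label.
  by move: (f (direction v)) (f (- direction v)) => j j'; case: ifP; lia.
Qed.

End LyusternikSchnirelmann.

(** * Hausdorff distance and the comparison of balls *)

Section HausdorffDistance.
Local Open Scope ereal_scope.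
Local Open Scope classical_set_scope.
Variables (R : realType) (Z : metricType R).
Implicit Types (A B : set Z) (a b : Z).

Lemma edist_inf_lt A z (r : R) : edist_inf A z < r%:E ->
  exists2 a, A a & (mdist z a < r)%R.
Proof.
by move=> /ereal_inf_lt[_ [a Aa <-]]; rewrite edist_mdist lte_fin; exists a.
Qed.

Lemma hausdorff_dist_ltl A B a (r : R) : hausdorff_dist A B < r%:E -> A a ->
  exists2 b, B b & (mdist a b < r)%R.
Proof.
rewrite gt_max => /andP[ABr _] Aa; apply: edist_inf_lt.
by apply: le_lt_trans ABr; apply: ereal_sup_ubound; exists a.
Qed.

Lemma hausdorff_dist_ltr A B b (r : R) : hausdorff_dist A B < r%:E -> B b ->
  exists2 a, A a & (mdist b a < r)%R.
Proof.
rewrite gt_max => /andP[_ ABr] Bb; apply: edist_inf_lt.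
by apply: le_lt_trans ABr; apply: ereal_sup_ubound; exists b.
Qed.

Lemma hausdorff_dist_ge0 A B : A !=set0 -> 0 <= hausdorff_dist A B.
Proof.
move=> [a Aa]; rewrite le_max; apply/orP; left.
apply: le_trans (edist_inf_ge0 B a) _.
by apply: ereal_sup_ubound; exists a.
Qed.

End HausdorffDistance.

Section Balls.
Local Open Scope classical_set_scope.
Local Open Scope ring_scope.
Variables (R : realType) (d : nat) (X Z : metricType R).
Variables (phi : unit_ball R d.+1 -> Z) (psi : X -> Z).
Hypothesis phi_iso : isometric_embedding phi.
Hypothesis psi_iso : isometric_embedding psi.

(** The colours are the indices [g p] of the points of [P]. Two unit vectors of
    equal colour are at distance less than [2 * (r + rho)], so the
    Lyusternik-Schnirelmann theorem with [eps = 2 - 2 * (r + rho)] excludes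
    [r + rho < 1]. *)
Lemma one_le_hausdorff_add_covering (P : set X) (r rho : R) :
  (P #<= `I_d.+1)%card ->
  (hausdorff_dist (range phi) (range psi) < r%:E)%E ->
  (hausdorff_dist P [set: X] < rho%:E)%E ->
  1 <= r + rho.
Proof.
move=> /pcard_leP/injfunPex[g gP g_inj] phi_psi P_cover.
rewrite leNgt; apply/negP => r_rho.
pose colours v (k : nat) := euclid_norm v = 1 ->
  exists (x : unit_ball R d.+1) (y p : X),
  [/\ ball_point x = v, P p, k = g p, mdist (phi x) (psi y) < r &
      mdist y p < rho].
have /choice[f f_spec] : forall v, exists k, colours v k.
  move=> v; have [v1|v1] := pselect (euclid_norm v = 1); last by exists 0%N.
  have v_ball : \sum_(i < d.+1) v 0 i ^+ 2 <= 1.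
    by rewrite -euclid_norm_sqr v1 expr1n.
  have [_ [y _ <-] xy] :=
    hausdorff_dist_ltl phi_psi (imageT phi (UnitBall v_ball)).
  have [p Pp yp] := hausdorff_dist_ltr P_cover (I : [set: X] y).
  by exists (g p) => _; exists (UnitBall v_ball), y, p.
have eps0 : 0 < 2 - 2 * (r + rho) by lra.
have f_lt v : euclid_norm v = 1 -> (f v < d.+1)%N.
  by move=> /f_spec[x [y [p [_ Pp -> _ _]]]]; exact: gP.
have [v [w [v1 w1 fvw]]] := lyusternik_schnirelmann eps0 f_lt.
have [x [y [p [xv Pp fv xy yp]]]] := f_spec v v1.
have [x' [y' [p' [xw Pp' fw xy' yp']]]] := f_spec w w1.
have pp' : p' = p by apply: g_inj; rewrite ?inE// -fv -fw.
move: yp'; rewrite pp' => yp'.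
have -> : euclid_dist v w = mdist x x' by rewrite -xv -xw.
have := phi_iso x x'; have := psi_iso y y'.
have := metric_triangle (phi x) (psi y) (phi x').
have := metric_triangle (psi y) (psi y') (phi x').
have := metric_triangle y p y'.
rewrite (metric_sym p y') (metric_sym (psi y') (phi x')).
lra.
Qed.

End Balls.

Theorem proposition3 (R : realType) (m n : nat) (n_ge1 : (1 <= n)%N)
    (n_lt_m : (n < m)%N) :
  (1%:E - covering_radius (unit_ball R n) m <=
   gh_dist (unit_ball R m) (unit_ball R n))%E.
Proof.
case: m n_lt_m => // d _.
(* Both Hausdorff distances are nonnegative, so each is a real number or +oo;
   the strict bounds needed on them cost e / 2 each. *)
apply: le_ereal_inf_tmp => _ [Z [phi [psi [phi_iso psi_iso ->]]]].
have zero_ball : (\sum_(i < d.+1) (0 : 'rV[R]_d.+1) ord0 i ^+ 2 <= 1)%R.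
  by rewrite big1// => i _; rewrite mxE expr0n.
have : (0 <= hausdorff_dist (range phi) (range psi))%E.
  apply: hausdorff_dist_ge0.
  by exists (phi (UnitBall zero_ball)), (UnitBall zero_ball).
case E : (hausdorff_dist _ _) => [h||] // _; last exact: leey.
rewrite lee_subel_addr// -leeBlDl//.
apply: le_ereal_inf_tmp => _ [P [P0 Pm] <-].
have := hausdorff_dist_ge0 setT P0.
case EP : (hausdorff_dist _ _) => [rho||] // _; last exact: leey.
rewrite leeBlDl// -EFinD lee_fin; apply/ler_addgt0Pr => e e0.
have e2 : (0 < e / 2)%R by rewrite divr_gt0.
have -> : (h + rho + e = (h + e / 2) + (rho + e / 2))%R by lra.
by apply: (one_le_hausdorff_add_covering phi_iso psi_iso Pm);
  rewrite ?E ?EP lte_fin ltrDl.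
Qed.
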